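(* Let $\mathcal{S}$ be the class of simple combinatorial auctions defined in the context, and call an auction in $\mathcal{S}$ convex if its payment function is a convex combination of the bids. For every convex auction in $\mathcal{S}$ and every arbitrarily small constant $\varepsilon>0$, the pure liquid price of stability of the auction over games in which all players have additive valuation functions is at least $2-\varepsilon$.
   Context: Setting: $m$ items are allocated to $n$ players. Player $i$ has a valuation function $v_i:2^{[m]}\to\mathbb{R}_{\ge 0}$ and a private budget $c_i\in\mathbb{R}_{\ge 0}$. A valuation is additive if $v_i(S\cup T)=v_i(S)+v_i(T)$ for disjoint $S,T\subseteq[m]$, i.e. $v_i(S)=\sum_{j\in S}v_i(\{j\})$. Class $\mathcal{S}$: each player $i$ submits bids $\mathbf{b}_i=(b_{ij})_{j\in[m]}$, $b_{ij}\ge 0$; $\mathbf{b}=(\mathbf{b}_i)_{i\in[n]}$ and $\mathbf{b}_{[j]}=(b_{ij})_{i\in[n]}$. An auction in $\mathcal{S}$ allocates each item $j$ independently to a player $\pi(j)$ with the highest bid for it ($b_{\pi(j),j}\ge b_{ij}$ for all $i$; items for which several players have the highest bid are given arbitrarily to one of these players), and charges $\pi(j)$ a payment $p_j(\mathbf{b}_{[j]})\in[0,b_{\pi(j),j}]$, where $p_j$ is non-decreasing and continuous in every bid. In a convex auction, $p_j(\mathbf{b}_{[j]})$ is a convex combination of the bids for item $j$ (examples: the winner pays her own bid; the winner pays the second highest bid). $\mathbf{X}(\mathbf{b})=(X_1,\dots,X_n)$ denotes the resulting allocation, a partition of $[m]$. Utility: $u_i(\mathbf{b})=v_i(X_i)-\sum_{j\in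 X_i}p_j(\mathbf{b}_{[j]})$ if player $i$'s total payment does not exceed $c_i$, and $-\infty$ otherwise. A bid matrix $\mathbf{b}$ is a pure Nash equilibrium if $u_i(\mathbf{b})\ge u_i(\mathbf{y},\mathbf{b}_{-i})$ for every player $i$ and every bid vector $\mathbf{y}$, where $(\mathbf{y},\mathbf{b}_{-i})$ is $\mathbf{b}$ with $\mathbf{b}_i$ replaced by $\mathbf{y}$. $\mathrm{EQ}(\mathcal{G})$ is the set of equilibria of the game $\mathcal{G}$. Conservative behavior (standing assumption): the sum of bids a player submits for any bundle of items exceeds neither her value for this bundle nor her budget, that is, $\sum_{j\in X_i}b_{ij}\le\min\{v_i(X_i),c_i\}$. Liquid welfare: for an allocation $\mathbf{X}$ (a partition of $[m]$ among the players), $\mathrm{LW}(\mathbf{X})=\sum_{i\in[n]}\min\{v_i(X_i),c_i\}$. The pure liquid price of stability of an auction is $\mathrm{LPoS}=\sup_{\mathcal{G}}\frac{\max_{\mathbf{Y}}\mathrm{LW}(\mathbf{Y})}{\max_{\mathbf{b}\in\mathrm{EQ}(\mathcal{G})}\mathrm{LW}(\mathbf{X}(\mathbf{b}))}$, the supremum being over all games induced by the auction. *)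

(* Defs.v *)
From HB Require Import structures.
From mathcomp Require Import all_boot all_order all_algebra.
From mathcomp Require Import all_classical all_reals all_analysis.
Import Order.TTheory GRing.Theory Num.Theory.
Import numFieldNormedType.Exports.

Set Implicit Arguments.
Unset Strict Implicit.
Unset Printing Implicit Defensive.

Local Open Scope ring_scope.

(** Conventions.  There are [n.+1 >= 1] players ['I_n.+1] and [m] items ['I_m].
    A bid matrix is a function [b : 'I_n.+1 -> 'I_m -> R]; the bids for item
    [j] form the vector [b^~ j].  An allocation, i.e. a partition of the items
    into possibly empty labelled parts, is a map from items to players. *)

Definition update (I : eqType) (T : Type) (f : I -> T) (i : I) (t : T) : I -> T :=
  fun k => if k == i then t else f k.

(** An auction is a format applicable to every number of players and items.
    Winner and payment of an item are functions of the bids for that item only;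
    in particular [winner] incorporates an arbitrary deterministic tie-breaking
    rule, which may depend on the item and on the bids for it.  Values on
    vectors with a negative entry are irrelevant. *)
Record auction (R : realType) := Auction {
  winner : forall n m, 'I_m -> ('I_n.+1 -> R) -> 'I_n.+1;
  payment : forall n m, 'I_m -> ('I_n.+1 -> R) -> R
}.

Definition nonneg_bids (R : realType) n (x : 'I_n.+1 -> R) : Prop :=
  forall i, 0 <= x i.

Record in_class_S (R : realType) (A : auction R) : Prop := InClassS {
  winner_highest : forall n m (j : 'I_m) (x : 'I_n.+1 -> R), nonneg_bids x ->
    forall i, x i <= x (winner A j x);
  payment_bounds : forall n m (j : 'I_m) (x : 'I_n.+1 -> R), nonneg_bids x ->
    0 <= payment A j x <= x (winner A j x);
  payment_nondecreasing : forall n m (j : 'I_m) (x : 'I_n.+1 -> R) i t,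
    nonneg_bids x -> x i <= t -> payment A j x <= payment A j (update x i t);
  payment_continuous : forall n m (j : 'I_m) (x : 'I_n.+1 -> R) i,
    nonneg_bids x ->
    {within [set t : R | 0 <= t],
      continuous (fun t : R => payment A j (update x i t))}%classic
}.

(** The weights may depend on the item and on the bids: this is needed already
    for first-price and second-price payments, in which the player whose bid
    is charged varies with the bids. *)
Definition convex_auction (R : realType) (A : auction R) : Prop :=
  forall n m (j : 'I_m) (x : 'I_n.+1 -> R), nonneg_bids x ->
    exists w : 'I_n.+1 -> R,
      [/\ forall i, 0 <= w i,
          \sum_(i < n.+1) w i = 1 &
          payment A j x = \sum_(i < n.+1) w i * x i].

Definition valuation (R : realType) m (f : {set 'I_m} -> R) : Prop :=
  forall S, 0 <= f S.

Definition additive_valuation (R : realType) m (f : {set 'I_m} -> R) : Prop :=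
  forall S T : {set 'I_m}, [disjoint S & T] -> f (S :|: T) = f S + f T.

Definition bundle n m (Y : {ffun 'I_m -> 'I_n.+1}) (i : 'I_n.+1) : {set 'I_m} :=
  [set j | Y j == i].

Definition allocation (R : realType) (A : auction R) n m
    (b : 'I_n.+1 -> 'I_m -> R) : {ffun 'I_m -> 'I_n.+1} :=
  [ffun j => winner A j (b^~ j)].

Definition LW (R : realType) n m (v : 'I_n.+1 -> {set 'I_m} -> R)
    (c : 'I_n.+1 -> R) (Y : {ffun 'I_m -> 'I_n.+1}) : R :=
  \sum_(i < n.+1) Order.min (v i (bundle Y i)) (c i).

Definition total_payment (R : realType) (A : auction R) n m
    (b : 'I_n.+1 -> 'I_m -> R) (i : 'I_n.+1) : R :=
  \sum_(j in bundle (allocation A b) i) payment A j (b^~ j).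

Definition utility (R : realType) (A : auction R) n m
    (v : 'I_n.+1 -> {set 'I_m} -> R) (c : 'I_n.+1 -> R)
    (b : 'I_n.+1 -> 'I_m -> R) (i : 'I_n.+1) : \bar R :=
  if total_payment A b i <= c i
  then (v i (bundle (allocation A b) i) - total_payment A b i)%:E
  else -oo%E.

Definition bid_matrix (R : realType) n m (b : 'I_n.+1 -> 'I_m -> R) : Prop :=
  forall i j, 0 <= b i j.

(** The bound is imposed on every bundle, not only on the one that is won. *)
Definition conservative (R : realType) n m (v : 'I_n.+1 -> {set 'I_m} -> R)
    (c : 'I_n.+1 -> R) (b : 'I_n.+1 -> 'I_m -> R) : Prop :=
  forall i (S : {set 'I_m}), \sum_(j in S) b i j <= Order.min (v i S) (c i).

Definition pure_nash (R : realType) (A : auction R) n m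
    (v : 'I_n.+1 -> {set 'I_m} -> R) (c : 'I_n.+1 -> R)
    (b : 'I_n.+1 -> 'I_m -> R) : Prop :=
  forall i (y : 'I_m -> R), (forall j, 0 <= y j) ->
    (utility A v c (update b i y) i <= utility A v c b i)%E.

(** Equilibrium bids are conservative, but are compared with all deviations. *)
Definition EQ (R : realType) (A : auction R) n m
    (v : 'I_n.+1 -> {set 'I_m} -> R) (c : 'I_n.+1 -> R) :
    set ('I_n.+1 -> 'I_m -> R) :=
  [set b | [/\ bid_matrix b, conservative v c b & pure_nash A v c b]]%classic.

(** [LW] takes finitely many values for fixed [v] and [c], so both suprema
    below are maxima (the second one when the game has an equilibrium). *)
Definition max_LW (R : realType) n m (v : 'I_n.+1 -> {set 'I_m} -> R)
    (c : 'I_n.+1 -> R) : \bar R :=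
  ereal_sup [set (LW v c Y)%:E | Y in [set: {ffun 'I_m -> 'I_n.+1}]]%classic.

Definition max_LW_EQ (R : realType) (A : auction R) n m
    (v : 'I_n.+1 -> {set 'I_m} -> R) (c : 'I_n.+1 -> R) : \bar R :=
  ereal_sup [set (LW v c (allocation A b))%:E | b in EQ A v c]%classic.

(** Pure liquid price of stability over the games whose valuations belong to
    the class [V].  The ratio makes sense only for games with an equilibrium.
    Division is the extended one: a ratio [x / 0] is [+oo] for [x > 0], and
    [0 / 0] is [0] (hence does not contribute to the supremum). *)
Definition LPoS (R : realType) (V : forall m, ({set 'I_m} -> R) -> Prop)
    (A : auction R) : \bar R :=
  ereal_sup [set r | exists n m (v : 'I_n.+1 -> {set 'I_m} -> R)
                            (c : 'I_n.+1 -> R),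
    [/\ forall i, valuation (v i) /\ V m (v i),
        forall i, 0 <= c i,
        (EQ A v c !=set0)%classic &
        r = (max_LW v c / max_LW_EQ A v c)%E]]%classic.

(* Main.v *)
(** Consider two players and two relevant items [x] and [y] with prices
    [q >> r > 0], and give both players the budget [q + r].  The weak player
    values [x] at [q] and [y] at [r]; the strong player [s] values [x] at
    [3 (q + r)] and [y] at [q + r].  Conservative bids of the weak player for
    [x] are at most [q], so [s] can always afford to outbid her and wins [x] in
    every equilibrium, where the liquid welfare is thus at most [q + 2 r].
    Giving [x] to the weak player and [y] to [s] yields [2 q + r].

    An equilibrium exists as soon as [s] wins both ties at the prices: all
    players bid the prices, by convexity the payments are then the prices, and
    by monotonicity no deviation lowers them.  Ties are broken arbitrarily, so
    give three items the prices [1], [d], [d ^ 2]; by pigeonhole the same player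
    wins the ties for two of them, and the third item is given value [0]. *)
Require Import Defs.
From mathcomp Require Import all_boot all_order all_algebra.
From mathcomp Require Import all_classical all_reals all_analysis.
From mathcomp Require Import lra.
Import Order.TTheory GRing.Theory Num.Theory.

Set Implicit Arguments.
Unset Strict Implicit.
Unset Printing Implicit Defensive.

Local Open Scope ring_scope.

(** * Additive valuations, payments and single-player deviations *)

Definition sum_valuation (R : realType) (m : nat) (f : 'I_m -> R) (S : {set 'I_m}) : R :=
  \sum_(j in S) f j.

Lemma sum_valuation_ge0 (R : realType) (m : nat) (f : 'I_m -> R) :
  (forall j, 0 <= f j) -> valuation (sum_valuation f).
Proof. by move=> f0 S; apply: sumr_ge0. Qed.

Lemma sum_valuation_additive (R : realType) (m : nat) (f : 'I_m -> R) :
  additive_valuation (sum_valuation f).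
Proof.
move=> S T dST; rewrite /sum_valuation -bigU //=.
by apply: eq_bigl => j; rewrite inE.
Qed.

Lemma payment_const (R : realType) (A : auction R) (n m : nat) (j : 'I_m) (t : R) :
  convex_auction A -> 0 <= t -> payment A j (fun _ : 'I_n.+1 => t) = t.
Proof.
move=> cA t0; have [w [_ w1 ->]] := cA n m j (fun=> t) (fun=> t0).
by rewrite -mulr_suml w1 mul1r.
Qed.

Lemma update_col (R : realType) (n m : nat) (b : 'I_n -> 'I_m -> R) (i : 'I_n)
    (y : 'I_m -> R) (j : 'I_m) :
  (update b i y)^~ j = update (b^~ j) i (y j).
Proof. by apply/funext => k; rewrite /update; case: eqP. Qed.

Lemma update_ge0 (R : realType) (n : nat) (x : 'I_n.+1 -> R) (i : 'I_n.+1) (t : R) :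
  nonneg_bids x -> 0 <= t -> nonneg_bids (update x i t).
Proof. by move=> x0 t0 k; rewrite /update; case: ifP. Qed.

Lemma utility_sum (R : realType) (A : auction R) (n m : nat)
    (f : 'I_n.+1 -> 'I_m -> R) (c : 'I_n.+1 -> R) (b : 'I_n.+1 -> 'I_m -> R)
    (i : 'I_n.+1) :
  total_payment A b i <= c i ->
  utility A (fun k => sum_valuation (f k)) c b i =
  (\sum_(j in bundle (allocation A b) i) (f i j - payment A j (b^~ j)))%:E.
Proof. by move=> le_c; rewrite /utility le_c /total_payment sumrB. Qed.

(** * Equilibria in which all players bid the same prices *)

Lemma winning_deviation_payment (R : realType) (A : auction R) (n m : nat)
    (j : 'I_m) (i : 'I_n.+2) (t y : R) :
  in_class_S A -> convex_auction A -> 0 <= t -> 0 <= y ->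
  winner A j (update (fun=> t) i y) = i ->
  t <= payment A j (update (fun=> t) i y).
Proof.
move=> SA cA t0 y0 win.
(* [lift i ord0] is a second player, still bidding [t], so the winning bid [y] is at least [t]. *)
have ty : t <= y.
  have := winner_highest SA j (update_ge0 i (fun=> t0) y0) (lift i ord0).
  by rewrite win /update eqxx eq_sym (negbTE (neq_lift _ _)).
rewrite -{1}(payment_const n.+1 j cA t0).
exact: payment_nondecreasing.
Qed.

(** Each item won by a deviation costs at least [t j], so an affordable deviation earns at most the
    sum of all margins [f i j - t j]. The uniform bids attain this sum, because the margins of lost
    items vanish. *)
Lemma uniform_bids_EQ (R : realType) (A : auction R) (n m : nat)
    (f : 'I_n.+2 -> 'I_m -> R) (c : 'I_n.+2 -> R) (t : 'I_m -> R) :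
  in_class_S A -> convex_auction A ->
  (forall j, 0 <= t j) -> (forall i j, t j <= f i j) ->
  (forall i j, winner A j (fun _ : 'I_n.+2 => t j) <> i -> f i j = t j) ->
  (forall i, \sum_j t j <= c i) ->
  EQ A (fun i => sum_valuation (f i)) c (fun _ => t).
Proof.
move=> SA cA t0 tf ft tc.
have sub_le (S : {set 'I_m}) : \sum_(j in S) t j <= \sum_j t j.
  by rewrite [leRHS](bigID (mem S)) /= lerDl sumr_ge0.
have pay_le i : total_payment A (fun _ : 'I_n.+2 => t) i <= c i.
  apply: le_trans (tc i); rewrite /total_payment.
  rewrite (eq_bigr t) => [|j _]; first exact: sub_le.
  exact: payment_const.
split.
- by move=> i j.
- move=> i S; rewrite le_min; apply/andP; split; first exact: ler_sum.
  exact: le_trans (sub_le S) (tc i).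
move=> i y y0.
rewrite (utility_sum _ (pay_le i)).
case: (leP (total_payment A (update (fun=> t) i y) i) (c i)) => [le_c|gt_c];
  last by rewrite /utility (lt_geF gt_c) leNye.
rewrite utility_sum // lee_fin.
apply: (@le_trans _ _ (\sum_j (f i j - t j))).
  rewrite [leRHS](bigID (mem (bundle (allocation A (update (fun=> t) i y)) i))) /=.
  rewrite ler_wpDr ?sumr_ge0 // => [j _|]; first by rewrite subr_ge0.
  apply: ler_sum => j; rewrite inE ffunE => /eqP; rewrite update_col => win.
  by rewrite lerB // winning_deviation_payment.
rewrite (bigID (mem (bundle (allocation A (fun=> t)) i))) /=.
rewrite [X in _ + X]big1 ?addr0 => [|j].
  by apply: ler_sum => j _; rewrite payment_const.
by rewrite inE ffunE => /eqP /ft ->; rewrite subrr.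
Qed.

(** * The two-player game and its liquid welfare *)

Definition game_price (R : realType) (m : nat) (x y : 'I_m) (q r : R) (j : 'I_m) : R :=
  if j == x then q else if j == y then r else 0.

(** The value [q + r] lets [y] alone exhaust the budget of [s]; the factor 3 makes [x] worth more to
    [s] than [y] and the whole budget together. *)
Definition game_value (R : realType) (m : nat) (s : 'I_2) (x y : 'I_m) (q r : R)
    (i : 'I_2) : 'I_m -> R :=
  if i == s then game_price x y (3 * (q + r)) (q + r)
  else game_price x y q r.

Lemma sum_game_price (R : realType) (m : nat) (x y : 'I_m) (q r : R) (S : {set 'I_m}) :
  x != y ->
  sum_valuation (game_price x y q r) S =
  (if x \in S then q else 0) + (if y \in S then r else 0).
Proof.
move=> xy; rewrite /sum_valuation.
rewrite (eq_bigr (fun j => (if j == x then q else 0) + (if j == y then r else 0))).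
  have single z (u : R) :
      \sum_(j in S) (if j == z then u else 0) = if z \in S then u else 0.
    rewrite big_mkcond (bigD1 z) //= eqxx big1 ?addr0 // => j /negbTE ->.
    by rewrite if_same.
  by rewrite big_split /= !single.
move=> j _; rewrite /game_price; case: (j =P x) => [->|_].
  by rewrite (negbTE xy) addr0.
by rewrite add0r.
Qed.

Lemma game_price_ge0 (R : realType) (m : nat) (x y : 'I_m) (q r : R) j :
  0 <= q -> 0 <= r -> 0 <= game_price x y q r j.
Proof. by move=> q0 r0; rewrite /game_price; do 2?case: ifP. Qed.

Lemma game_value_ge0 (R : realType) (m : nat) (s : 'I_2) (x y : 'I_m) (q r : R) i j :
  0 <= q -> 0 <= r -> 0 <= game_value s x y q r i j.
Proof.
by move=> q0 r0; rewrite /game_value; case: ifP => _; apply: game_price_ge0; lra.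
Qed.

(** Only [s] values items above their prices, namely [x] and [y], and she wins both ties. *)
Lemma game_uniform_EQ (R : realType) (A : auction R) (m : nat) (s : 'I_2)
    (x y : 'I_m) (q r : R) :
  in_class_S A -> convex_auction A -> x != y -> 0 < q -> 0 < r ->
  winner A x (fun _ : 'I_2 => q) = s -> winner A y (fun _ : 'I_2 => r) = s ->
  EQ A (fun i => sum_valuation (game_value s x y q r i)) (fun=> q + r)
    (fun=> game_price x y q r).
Proof.
move=> SA cA xy q0 r0 wx wy; apply: uniform_bids_EQ => //.
- by move=> j; apply: game_price_ge0; exact: ltW.
- move=> i j; rewrite /game_value; case: ifP => _ //.
  by rewrite /game_price; do 2?case: ifP => _ //; lra.
- move=> i j; rewrite /game_value /game_price; case: (i =P s) => [->|] //.
  case: (j =P x) => [->|_]; first by rewrite wx.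
  by case: (j =P y) => [->|_] //; rewrite wy.
- move=> _; have := sum_game_price q r [set: 'I_m] xy.
  rewrite /sum_valuation !inE => <-.
  by under [leRHS]eq_bigl => j do rewrite inE.
Qed.

Lemma game_EQ_winner (R : realType) (A : auction R) (m : nat) (s : 'I_2)
    (x y : 'I_m) (q r : R) (b : 'I_2 -> 'I_m -> R) :
  in_class_S A -> x != y -> 0 < q -> 0 < r ->
  EQ A (fun i => sum_valuation (game_value s x y q r i)) (fun=> q + r) b ->
  allocation A b x = s.
Proof.
move=> SA xy q0 r0 [b0 cons nash].
set v := fun i => _ in cons nash.
(* [s] deviates by spending the whole budget on [x], out of the weak player's reach. *)
pose d (j : 'I_m) : R := if j == x then q + r else 0.
have d0 j : 0 <= d j by rewrite /d; case: ifP => _ //; lra.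
have ud0 j : nonneg_bids ((update b s d)^~ j).
  by rewrite update_col; apply: update_ge0 => // k; exact: b0.
have win_x : allocation A (update b s d) x = s.
  rewrite ffunE; apply/eqP/negPn/negP => ns.
  have := winner_highest SA x (ud0 x) s.
  rewrite {1 2}/update eqxx (negbTE ns) {1}/d eqxx.
  set k := winner _ _ _ in ns *.
  have := cons k [set x]; rewrite le_min => /andP[+ _].
  rewrite big_set1 /v /sum_valuation big_set1 /game_value (negbTE ns) /game_price eqxx.
  by move=> ? ?; lra.
(* Zero bids may win further items, but payments never exceed the winner's own bids, and those in
   [d] sum to [q + r]. *)
have pay_d : total_payment A (update b s d) s <= q + r.
  apply: (@le_trans _ _ (\sum_(j in bundle (allocation A (update b s d)) s) d j)).
    apply: ler_sum => j; rewrite inE ffunE => /eqP wj.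
    have /andP[_] := payment_bounds SA j (ud0 j).
    by rewrite wj {2}/update eqxx.
  apply: (@le_trans _ _ (\sum_j d j)).
    by rewrite [leRHS](bigID (mem (bundle (allocation A (update b s d)) s))) /= lerDl sumr_ge0.
  by rewrite (bigD1 x) //= big1 ?addr0 /d ?eqxx // => j /negbTE ->.
have pay0 : 0 <= total_payment A b s.
  apply: sumr_ge0 => j _.
  by have /andP[] := payment_bounds SA j (fun k => b0 k j).
have := nash s d d0.
rewrite /utility pay_d.
case: ifP => [_|]; last by rewrite leeNy_eq.
rewrite lee_fin /v /game_value eqxx !sum_game_price // !inE win_x eqxx.
(* Without [x], [s] gets at most [q + r]; the deviation yields at least [2 * (q + r)]. *)
case: (allocation A b x =P s) => // _; do 2![case: ifP => _] => ?; exfalso; lra.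
Qed.

Lemma LW_two (R : realType) (m : nat) (s : 'I_2) (v : 'I_2 -> {set 'I_m} -> R)
    (c : 'I_2 -> R) (Y : {ffun 'I_m -> 'I_2}) :
  LW v c Y = Order.min (v s (bundle Y s)) (c s) +
    Order.min (v (lift s ord0) (bundle Y (lift s ord0))) (c (lift s ord0)).
Proof.
rewrite /LW (bigD1 s) //= (big_pred1 (lift s ord0)) // => i /=.
case: (unliftP s i) => [j ->|->]; last by rewrite eqxx (negbTE (neq_lift _ _)).
by rewrite ord1 eqxx eq_sym neq_lift.
Qed.

(** Since [s] wins [x], her share is capped at the budget, and the weak player can gain at most [r]
    from [y]. *)
Lemma game_EQ_LW (R : realType) (A : auction R) (m : nat) (s : 'I_2)
    (x y : 'I_m) (q r : R) (b : 'I_2 -> 'I_m -> R)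
    (v := fun i => sum_valuation (game_value s x y q r i)) (c := fun=> q + r) :
  in_class_S A -> x != y -> 0 < q -> 0 < r -> EQ A v c b ->
  q + r <= LW v c (allocation A b) <= q + r + r.
Proof.
move=> SA xy q0 r0 /[dup] /game_EQ_winner win [_ _ _].
rewrite (LW_two s) /v /c /game_value eqxx eq_sym (negbTE (neq_lift _ _)).
rewrite !sum_game_price // !inE win // eqxx (negbTE (neq_lift _ _)).
have -> : Num.min (3 * (q + r) + (if allocation A b y == s then q + r else 0)) (q + r) = q + r.
  by apply/min_idPr; case: ifP => _; lra.
rewrite add0r; case: ifP => _; first by rewrite min_l; lra.
by rewrite min_l; lra.
Qed.

Lemma game_LPoS (R : realType) (A : auction R) (m : nat) (s : 'I_2)
    (x y : 'I_m) (q r : R) :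
  in_class_S A -> convex_auction A -> x != y -> 0 < q -> 0 < r ->
  winner A x (fun _ : 'I_2 => q) = s -> winner A y (fun _ : 'I_2 => r) = s ->
  (((2 * q + r) / (q + 2 * r))%:E <= LPoS (@additive_valuation R) A)%E.
Proof.
move=> SA cA xy q0 r0 wx wy.
pose v (i : 'I_2) := sum_valuation (game_value s x y q r i).
pose c (i : 'I_2) := q + r.
have eqb : EQ A v c (fun=> game_price x y q r) by exact: game_uniform_EQ.
apply: (@le_trans _ _ (max_LW v c / max_LW_EQ A v c)%E); last first.
  apply: ereal_sup_ubound; exists 1%N, m, v, c; split => //.
  - move=> i; split; last exact: sum_valuation_additive.
    by apply: sum_valuation_ge0 => j; apply: game_value_ge0; exact: ltW.
  - by move=> i; rewrite /c; lra.
  - by exists (fun=> game_price x y q r).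
have opt : ((2 * q + r)%:E <= max_LW v c)%E.
  apply: ereal_sup_ge.
  pose Y := [ffun j : 'I_m => if j == y then s else lift s ord0].
  exists (LW v c Y)%:E; first by exists Y.
  rewrite lee_fin (LW_two s) /v /c /game_value eqxx eq_sym (negbTE (neq_lift _ _)).
  rewrite !sum_game_price // !inE !ffunE eqxx (negbTE xy) eqxx eq_sym (negbTE (neq_lift _ _)).
  rewrite eqxx add0r addr0 minxx min_l; lra.
have eq_ub : (max_LW_EQ A v c <= (q + 2 * r)%:E)%E.
  apply: ge_ereal_sup => _ [b /(game_EQ_LW SA xy q0 r0) /andP[_ h] <-].
  by rewrite lee_fin; apply: le_trans h _; lra.
(* This excludes [-oo] and makes the denominator positive. *)
have eq_lb : ((q + r)%:E <= max_LW_EQ A v c)%E.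
  have /andP[h _] := game_EQ_LW SA xy q0 r0 eqb.
  by apply: ereal_sup_ge; eexists; [by eexists; [exact: eqb|] | rewrite lee_fin].
case: (max_LW_EQ A v c) eq_ub eq_lb => [M| |] //.
rewrite !lee_fin => Mub Mlb.
have M0 : 0 < M by lra.
rewrite inver gt_eqF // EFinM; apply: lee_pmul => //.
- by rewrite lee_fin; lra.
- by rewrite lee_fin invr_ge0; lra.
- by rewrite lee_fin lef_pV2 // posrE; lra.
Qed.

Theorem theorem4 (R : realType) (A : auction R) (eps : R) :
  in_class_S A -> convex_auction A -> 0 < eps ->
  ((2 - eps)%:E <= LPoS (@additive_valuation R) A)%E.
Proof.
move=> SA cA eps0.
(* With [r <= d * q], the ratio falls short of 2 by [3 * r / (q + 2 * r)], at most [3 * d], hence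
   below [eps]. The cap 1 makes the powers of [d] non-increasing, so any two of the three prices
   qualify. *)
pose d : R := Num.min 1 (eps / 4).
have d0 : 0 < d by rewrite lt_min ltr01 divr_gt0.
have d1 : d <= 1 by rewrite ge_min lexx.
have de : d <= eps / 4 by rewrite ge_min lexx orbT.
pose g (j : 'I_3) := winner A j (fun _ : 'I_2 => d ^+ j).
have [j [k [jk gjk]]] : exists j k : 'I_3, (j < k)%N /\ g j = g k.
  have : ~~ injectiveb g.
    by apply/negP => /injectiveP /leq_card; rewrite !card_ord.
  case/injectivePn => j [k jk gjk].
  case: (ltngtP j k) => [lt_jk|lt_kj|/val_inj eq_jk].
  - by exists j, k.
  - by exists k, j.
  - by rewrite eq_jk eqxx in jk.
have j0 : 0 < d ^+ j by rewrite exprn_gt0.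
have k0 : 0 < d ^+ k by rewrite exprn_gt0.
have kj : d ^+ k <= d * d ^+ j by rewrite -exprS ler_wiXn2l // ltW.
apply: le_trans (game_LPoS SA cA _ j0 k0 erefl (esym gjk)).
  rewrite lee_fin ler_pdivlMr; last by lra.
  case: (leP eps 2) => e2; nra.
by rewrite neq_ltn jk.
Qed.
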